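(* Let $d$ be a positive integer and $0\le k\le n$ integers. Then $$\det\left((-1)^{\binom{i-j}{2}}\binom{n}{k-i+j}_F\right)_{i,j=0}^{d-1}=\left\langle \begin{matrix} n\\ k\end{matrix}\right\rangle_{d,F}.$$ In particular all $\left\langle \begin{matrix} n\\ k\end{matrix}\right\rangle_{d,F}$ are positive integers.
   Context: $F_n$ are the Fibonacci numbers ($F_0=0$, $F_1=1$, $F_n=F_{n-1}+F_{n-2}$). Fibonomial coefficients: $\binom{m}{k}_F=\prod_{j=0}^{k-1}\frac{F_{m-j}}{F_{k-j}}$ for $0\le k\le m$, and $0$ if $k<0$ or $k>m$. Fibo-Hoggatt numbers: for $0\le k\le n$, $\left\langle \begin{matrix} n\\ k\end{matrix}\right\rangle_{d,F}=\prod_{j=0}^{k-1}\frac{\binom{n-j+d-1}{d}_F}{\binom{k-j+d-1}{d}_F}$. For any integer $m$, $\binom{m}{2}=m(m-1)/2$. *)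

(* Defs.v *)
From HB Require Import structures.
From mathcomp Require Import all_boot all_order all_algebra.
Set Implicit Arguments.
Unset Strict Implicit.
Unset Printing Implicit Defensive.
Import Order.TTheory GRing.Theory Num.Theory.
Local Open Scope ring_scope.

Fixpoint fib (n : nat) : nat :=
  match n with
  | 0 => 0
  | 1 => 1
  | (p.+1 as q).+1 => fib q + fib p
  end%N.

(* The quotients are taken in rat, integrality not being known a priori; the
   lower index is an int because it may be negative. The natural-number
   subtractions are never truncated, since j < k <= m. *)
Definition fibonomial (m : nat) (k : int) : rat :=
  match k with
  | Posz k => if (k <= m)%N
              then \prod_(0 <= j < k) ((fib (m - j))%:R / (fib (k - j))%:R)
              else 0
  | Negz _ => 0
  end.

(* Meant for 0 < d and k <= n: then no subtraction is truncated and no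
   denominator vanishes. *)
Definition fibo_hoggatt (d n k : nat) : rat :=
  \prod_(0 <= j < k)
    (fibonomial (n - j + d - 1) d%:Z / fibonomial (k - j + d - 1) d%:Z).

(* m(m-1)/2 for an arbitrary integer m; the division is exact. *)
Definition binom2 (m : int) : int := ((m * (m - 1)) %/ 2)%Z.

(* Main.v *)
(* Write D_d(k) for the determinant. Since binom(m+1,2) = binom(m,2) + m,
   deleting the first row and the last column (or conversely) of the matrix of
   D_d(k) gives, up to diagonal sign matrices, the matrix of D_(d-1)(k-1) (or
   D_(d-1)(k+1)), so the Desnanot-Jacobi identity reads
     D_(d+2)(k) D_d(k) = D_(d+1)(k)^2 + (-1)^d D_(d+1)(k-1) D_(d+1)(k+1).
   With K(m) the product of the first m Fibonacci factorials and c = n - k, the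
   Fibo-Hoggatt number is the MacMahon-type quotient
     K(d+k+c) K(d) K(k) K(c) / (K(d+k) K(d+c) K(k+c)),
   and it satisfies the same recurrence by Vajda's identity. These numbers are
   positive, so the recurrence determines D_d by induction on d. Integrality
   follows because the fibonomials are integers, by their Pascal-type rule. *)
Require Import Defs.
From HB Require Import structures.
From mathcomp Require Import all_boot all_order all_algebra.
From mathcomp Require Import perm zify ring.
Set Implicit Arguments.
Unset Strict Implicit.
Unset Printing Implicit Defensive.
Import Order.TTheory GRing.Theory Num.Theory.
Local Open Scope ring_scope.

(** * Minors and condensation *)

(** Entries indexed by [nat] instead of ordinals allow submatrices to be taken by composing [f] with
    index maps, without casts. *)
Definition leading_minor (R : comNzRingType) (f : nat -> nat -> R) (m : nat) : R :=
  \det (\matrix_(i < m, j < m) f i j).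

Lemma eq_leading_minor (R : comNzRingType) (f g : nat -> nat -> R) m :
  (forall i j, (i < m)%N -> (j < m)%N -> f i j = g i j) ->
  leading_minor f m = leading_minor g m.
Proof.
by move=> fg; congr (\det _); apply/matrixP => i j; rewrite !mxE fg.
Qed.

Lemma leading_minor_scale (R : comNzRingType) (f : nat -> nat -> R)
    (u v : nat -> R) m :
  leading_minor (fun i j => u i * f i j * v j) m
  = \prod_(i < m) u i * leading_minor f m * \prod_(j < m) v j.
Proof.
have -> : leading_minor (fun i j => u i * f i j * v j) m =
    \det (diag_mx (\row_(i < m) u i) *m (\matrix_(i < m, j < m) f i j)
          *m diag_mx (\row_(j < m) v j)).
  congr (\det _); apply/matrixP => i j.
  by rewrite mul_diag_mx mul_mx_diag !mxE.
rewrite !det_mulmx !det_diag.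
by do !congr (_ * _); apply: eq_bigr => i _; rewrite mxE.
Qed.

Lemma det_mx2 (R : comNzRingType) (A : 'M[R]_2) :
  \det A = A 0 0 * A 1 1 - A 0 1 * A 1 0.
Proof.
rewrite (expand_det_row A 0) !big_ord_recl big_ord0 /cofactor !det_mx11 !mxE /=.
rewrite expr0 expr1 mul1r mulN1r mulrN addr0.
by congr (_ * A _ _ - A _ _ * A _ _); apply/val_inj.
Qed.

(** Block LU factorization, with the Schur complement in the upper triangular factor. *)
Lemma det_schur (R : comUnitRingType) n m (A : 'M[R]_(n + m)) :
  ulsubmx A \in unitmx ->
  \det A = \det (ulsubmx A) *
           \det (drsubmx A - dlsubmx A *m invmx (ulsubmx A) *m ursubmx A).
Proof.
move=> uA; rewrite -[in LHS](submxK A).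
set M := ulsubmx A in uA *; set U := ursubmx A; set V := dlsubmx A.
have -> : block_mx M U V (drsubmx A) =
    block_mx M 0 V 1%:M *m
    block_mx 1%:M (invmx M *m U) 0 (drsubmx A - V *m invmx M *m U).
  rewrite mulmx_block !mulmx1 !mul0mx !mulmx0 !addr0 !mul1mx mulmxA mulmxV //.
  by rewrite mul1mx mulmxA addrC subrK.
by rewrite det_mulmx det_lblock det_ublock !det1 mulr1 mul1r.
Qed.

(* Sylvester's identity for the two rows and columns bordering a leading
   block; [bump n a] is [n.+1] at [a = n] and [a] below, so it exchanges the
   first border row (or column) for the second one. *)
Lemma leading_minor_border2 (K : fieldType) (g : nat -> nat -> K) n :
  leading_minor g n != 0 ->
  leading_minor g n.+2 * leading_minor g n =
    leading_minor g n.+1 * leading_minor (fun a b => g (bump n a) (bump n b)) n.+1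
    - leading_minor (fun a b => g a (bump n b)) n.+1
      * leading_minor (fun a b => g (bump n a) b) n.+1.
Proof.
move=> g_nz; set M := \matrix_(i < n, j < n) g i j.
have uM : M \in unitmx by rewrite unitmxE unitfE.
(* [S a b] is the Schur complement of [M] bordered by row [a] and column [b]. Up to the factor
   [leading_minor g n], the minors of order [n.+1] are single values of [S] and the one of order
   [n.+2] is a 2 by 2 determinant of them. *)
pose S (a b : nat) : K := g a b
  - ((\row_(j < n) g a j) *m invmx M *m (\col_(i < n) g i b)) 0 0.
have S1 (r c : nat -> nat) :
    (forall a, (a < n)%N -> r a = a) -> (forall a, (a < n)%N -> c a = a) ->
    leading_minor (fun a b => g (r a) (c b)) n.+1
    = leading_minor g n * S (r n) (c n).
  move=> rn cn; rewrite /leading_minor -[n.+1]addn1.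
  set A := \matrix_(_, _) _.
  have AM : ulsubmx A = M by apply/matrixP => i j; rewrite !mxE /= rn ?cn.
  rewrite det_schur AM // det_mx11; congr (_ * _); rewrite !mxE /= !addn0.
  congr (_ - _); rewrite mxE; apply: eq_bigr => j _.
  rewrite !mxE /= addn0 (rn j) //; congr (_ * _).
  by apply: eq_bigr => i _; rewrite !mxE /= addn0 cn.
have S2 : leading_minor g n.+2
    = leading_minor g n * (S n n * S n.+1 n.+1 - S n n.+1 * S n.+1 n).
  rewrite /leading_minor -[n.+2]addn2; set A := \matrix_(_, _) _.
  have AM : ulsubmx A = M by apply/matrixP => i j; rewrite !mxE.
  have SE (i j : 'I_2) :
    (drsubmx A - dlsubmx A *m invmx M *m ursubmx A) i j
    = S (n + i)%N (n + j)%N.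
    rewrite !mxE /=; congr (_ - _); rewrite mxE; apply: eq_bigr => k _.
    rewrite !mxE /=; congr (_ * _).
    by apply: eq_bigr => l _; rewrite !mxE.
  by rewrite det_schur AM // det_mx2 !SE /= addn0 addn1.
have bl a : (a < n)%N -> bump n a = a by rewrite /bump ltnNge => /negbTE->.
have bn : bump n n = n.+1 by rewrite /bump leqnn.
rewrite S2 (S1 id id) // (S1 _ _ bl bl) (S1 id _ _ bl) // (S1 _ id bl) // bn.
by ring.
Qed.

(** Fixing everything above [n] lets one map serve both order [n.+1], where it is the cyclic shift,
    and order [n.+2]. *)
Definition rot1 (n a : nat) : nat :=
  if (a < n)%N then a.+1 else if a == n then 0%N else a.

Lemma rot1_ordS n (i : 'I_n.+1) : rot1 n i = ordS i.
Proof.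
rewrite /rot1 /=; case: (ltngtP i n) (ltn_ord i) => [lin _|lni|-> _].
- by rewrite modn_small.
- by rewrite ltnNge lni.
- by rewrite modnn.
Qed.

(** The sign is left as a permutation parity: it will only occur squared. *)
Lemma leading_minor_rot1_row (R : comNzRingType) (f : nat -> nat -> R) n :
  leading_minor (fun a b => f (rot1 n a) b) n.+1
  = (-1) ^+ perm (bij_inj (@ordS_bij n.+1)) * leading_minor f n.+1.
Proof.
rewrite -det_perm -det_mulmx -row_permE; congr (\det _).
by apply/matrixP => i j; rewrite !mxE permE rot1_ordS.
Qed.

Lemma leading_minor_tr (R : comNzRingType) (f : nat -> nat -> R) n :
  leading_minor (fun a b => f b a) n = leading_minor f n.
Proof.
by rewrite /leading_minor -det_tr; congr (\det _); apply/matrixP=> i j; rewrite !mxE.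
Qed.

Lemma leading_minor_rot1_col (R : comNzRingType) (f : nat -> nat -> R) n :
  leading_minor (fun a b => f a (rot1 n b)) n.+1
  = (-1) ^+ perm (bij_inj (@ordS_bij n.+1)) * leading_minor f n.+1.
Proof.
rewrite -leading_minor_tr (leading_minor_rot1_row (fun a b => f b a)).
by rewrite leading_minor_tr.
Qed.

(* Applied to the rows and columns [1, ..., n, 0, n+1]: the sign of this
   rearrangement cancels in every term. *)
Lemma desnanot_jacobi (K : fieldType) (f : nat -> nat -> K) n :
  leading_minor (fun a b => f a.+1 b.+1) n != 0 ->
  leading_minor f n.+2 * leading_minor (fun a b => f a.+1 b.+1) n =
    leading_minor f n.+1 * leading_minor (fun a b => f a.+1 b.+1) n.+1
    - leading_minor (fun a b => f a b.+1) n.+1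
      * leading_minor (fun a b => f a.+1 b) n.+1.
Proof.
move=> nz; pose g a b := f (rot1 n a) (rot1 n b).
have rl a : (a < n)%N -> rot1 n a = a.+1 by rewrite /rot1 => ->.
(* Skipping position [n] in the order 1, ..., n, 0, n+1 drops the index 0. *)
have rb a : (a < n.+1)%N -> rot1 n (bump n a) = a.+1.
  rewrite ltnS /bump; case: (leqP n a) => [lna lan|lan _]; last exact: rl.
  have -> : a = n by apply/eqP; rewrite eqn_leq lan.
  by rewrite /rot1 ltnNge leqnSn gtn_eqF.
have gn : leading_minor g n = leading_minor (fun a b => f a.+1 b.+1) n.
  by apply: eq_leading_minor => i j li lj; rewrite /g !rl.
have e2 : leading_minor g n.+2 = leading_minor f n.+2.
  rewrite /leading_minor.
  pose s := lift_perm ord_max ord_max (perm (bij_inj (@ordS_bij n.+1))).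
  have sE (i : 'I_n.+2) : rot1 n i = s i.
    case: (unliftP ord_max i) => [j|] ->.
      by rewrite lift_perm_lift !lift_max permE rot1_ordS.
    by rewrite lift_perm_id /= /rot1 ltnNge leqnSn /= gtn_eqF.
  have -> : \matrix_(i < n.+2, j < n.+2) g i j =
      row_perm s (col_perm s (\matrix_(i < n.+2, j < n.+2) f i j)).
    by apply/matrixP => i j; rewrite !mxE /g !sE.
  rewrite row_permE col_permE !det_mulmx !det_perm odd_permV mulrCA -signr_addb.
  by rewrite addbb expr0 mulr1.
rewrite -gn in nz *; rewrite -e2 leading_minor_border2 //.
have -> : leading_minor g n.+1 = leading_minor f n.+1.
  rewrite (leading_minor_rot1_row (fun a b => f a (rot1 n b))).
  by rewrite leading_minor_rot1_col mulrA -signr_addb addbb mul1r.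
have -> : leading_minor (fun a b => g (bump n a) (bump n b)) n.+1
    = leading_minor (fun a b => f a.+1 b.+1) n.+1.
  by apply: eq_leading_minor => i j li lj; rewrite /g !rb.
have -> : leading_minor (fun a b => g a (bump n b)) n.+1
    = leading_minor (fun a b => f (rot1 n a) b.+1) n.+1.
  by apply: eq_leading_minor => i j li lj; rewrite /g !rb.
have -> : leading_minor (fun a b => g (bump n a) b) n.+1
    = leading_minor (fun a b => f a.+1 (rot1 n b)) n.+1.
  by apply: eq_leading_minor => i j li lj; rewrite /g !rb.
rewrite (leading_minor_rot1_row (fun a b => f a b.+1)).
rewrite (leading_minor_rot1_col (fun a b => f a.+1 b)).
by rewrite mulrACA -signr_addb addbb mul1r.
Qed.

Lemma leading_minor_zero_row (R : comNzRingType) (f : nat -> nat -> R) d i :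
  (i < d)%N -> (forall j, f i j = 0) -> leading_minor f d = 0.
Proof.
move=> id fi0; rewrite /leading_minor (expand_det_row _ (Ordinal id)).
by rewrite big1 // => j _; rewrite mxE fi0 mul0r.
Qed.

Lemma leading_minor_int (f : nat -> nat -> rat) d :
  (forall i j, f i j \is a Num.int) -> leading_minor f d \is a Num.int.
Proof.
move=> fZ; apply: rpred_sum => s _.
rewrite rpredMsign; apply: rpred_prod => i _.
by rewrite mxE.
Qed.

(** * Fibonomials and Fibo-Hoggatt numbers *)

Local Notation F n := ((fib n)%:R : rat).

Lemma fibSS n : F n.+2 = F n.+1 + F n.
Proof. by rewrite -natrD. Qed.

Lemma fib_gt0 n : (0 < fib n.+1)%N.
Proof.
elim: n => // n IH; rewrite -[fib n.+2]/(fib n.+1 + fib n)%N.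
by rewrite addn_gt0 IH.
Qed.

Lemma fibS_gt0 n : 0 < F n.+1.
Proof. by rewrite ltr0n fib_gt0. Qed.

Lemma fibS_neq0 n : F n.+1 != 0.
Proof. by rewrite gt_eqF ?fibS_gt0. Qed.

Lemma fibD m n : F (m + n).+1 = F m * F n + F m.+1 * F n.+1.
Proof.
elim: m n => [|m IH] n; first by rewrite add0n mul0r mul1r add0r.
rewrite addSnnS IH !fibSS; by ring.
Qed.

Lemma fib_cassini n : F n.+1 ^+ 2 - F n * F n.+1 - F n ^+ 2 = (-1) ^+ n.
Proof.
elim: n => [|n IH]; first by rewrite /= mul0r expr1n expr0n /= !subr0.
by rewrite [(-1) ^+ n.+1]exprS -IH fibSS; ring.
Qed.

(** Cassini turns the sign into a quadratic form in [F d] and [F d.+1]; after expansion by [fibD]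
    the identity is polynomial. *)
Lemma fib_vajda d c k :
  F (c + k + d).+1 * F d.+1
  = F (c + d).+1 * F (k + d).+1 + (-1) ^+ d * (F c * F k).
Proof.
rewrite -fib_cassini !(fibD _ d) (fibD c k).
(* The difference stands for the Fibonacci number of index k-1, and is correct at k = 0 too. *)
have -> : F (c + k) = F c * (F k.+1 - F k) + F c.+1 * F k.
  case: k => [|k]; first by rewrite addn0 /= subr0 mulr1 mulr0 addr0.
  by rewrite addnS fibD fibSS; ring.
by ring.
Qed.

Fixpoint fibfact (n : nat) : rat :=
  if n is m.+1 then F n * fibfact m else 1.

(** This is K(n), the Fibonacci analogue of the Barnes function G(n+1). *)
Fixpoint fibsuperfact (n : nat) : rat :=
  if n is m.+1 then fibfact m * fibsuperfact m else 1.

Lemma fibfactS n : fibfact n.+1 = F n.+1 * fibfact n.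
Proof. by []. Qed.

Lemma fibsuperfactS n : fibsuperfact n.+1 = fibfact n * fibsuperfact n.
Proof. by []. Qed.

Lemma fibfact_gt0 n : 0 < fibfact n.
Proof. by elim: n => [|n IH] //=; rewrite mulr_gt0 ?fibS_gt0. Qed.

Lemma fibsuperfact_gt0 n : 0 < fibsuperfact n.
Proof. by elim: n => [|n IH] //=; rewrite mulr_gt0 ?fibfact_gt0. Qed.

Lemma fibfact_neq0 n : fibfact n != 0.
Proof. by rewrite gt_eqF ?fibfact_gt0. Qed.

Lemma fibsuperfact_neq0 n : fibsuperfact n != 0.
Proof. by rewrite gt_eqF ?fibsuperfact_gt0. Qed.

Lemma fibonomialE m k : (k <= m)%N ->
  fibonomial m k = fibfact m / (fibfact k * fibfact (m - k)).
Proof.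
rewrite /fibonomial => lkm; rewrite lkm.
elim: k m lkm => [|k IH] m lkm.
  by rewrite big_geq // subn0 mul1r divff ?fibfact_neq0.
case: m lkm => // m lkm.
rewrite big_nat_recl // subn0 subSS.
under eq_bigr do rewrite !subSS.
rewrite IH // !fibfactS.
by field; rewrite !fibfact_neq0 fibS_neq0.
Qed.

Lemma fibonomial_small m k : (m < k)%N -> fibonomial m k = 0.
Proof. by rewrite /fibonomial ltnNge => /negbTE->. Qed.

Lemma fibonomial0 m : fibonomial m 0 = 1.
Proof. by rewrite fibonomialE // subn0 mul1r divff ?fibfact_neq0. Qed.

Lemma fibonomialnn m : fibonomial m m = 1.
Proof. by rewrite fibonomialE // subnn mulr1 divff ?fibfact_neq0. Qed.

(** The addition formula splits the top factor [F (k + l).+2] of the numerator. *)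
Lemma fibonomialS k l :
  fibonomial (k + l).+2 k.+1
  = F k.+2 * fibonomial (k + l).+1 k.+1 + F l * fibonomial (k + l).+1 k.
Proof.
rewrite !fibonomialE; try lia.
have -> : ((k + l).+2 - k.+1 = l.+1)%N by lia.
have -> : ((k + l).+1 - k.+1 = l)%N by lia.
have -> : ((k + l).+1 - k = l.+1)%N by lia.
have eF : F (k + l).+2 = F k.+1 * F l + F k.+2 * F l.+1.
  by rewrite -addSn fibD.
rewrite (fibfactS (k + l).+1) eF (fibfactS k) (fibfactS l).
by field; rewrite !fibfact_neq0 !fibS_neq0.
Qed.

Lemma fibonomial_int m k : fibonomial m k \is a Num.int.
Proof.
case: k => [k|k]; last exact: rpred0.
elim: m k => [|m IH] k.
  by case: k => [|k]; [rewrite fibonomial0 rpred1 | rewrite fibonomial_small ?rpred0].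
case: k => [|k]; first by rewrite fibonomial0 rpred1.
case: (ltngtP k m) => [lkm|lmk|->].
- have -> : m = (k + (m - k.+1)).+1 by lia.
  rewrite fibonomialS -(_ : m = (k + (m - k.+1)).+1); last by lia.
  by rewrite rpredD ?rpredM ?IH ?natr_int.
- by rewrite fibonomial_small ?rpred0.
- by rewrite fibonomialnn rpred1.
Qed.

(** With n in place of each Fibonacci number, this is MacMahon's count of plane partitions in an a
    by b by c box. *)
Definition fibbox (a b c : nat) : rat :=
  (fibsuperfact (a + b + c) * fibsuperfact a * fibsuperfact b * fibsuperfact c)
  / (fibsuperfact (a + b) * fibsuperfact (a + c) * fibsuperfact (b + c)).

Lemma fibbox_gt0 a b c : 0 < fibbox a b c.
Proof. by rewrite /fibbox divr_gt0 ?mulr_gt0 ?fibsuperfact_gt0. Qed.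

Lemma fibbox0 a b : fibbox a 0 b = 1.
Proof.
rewrite /fibbox !addn0 add0n [fibsuperfact 0]/=.
by field; rewrite !fibsuperfact_neq0.
Qed.

Lemma fibboxC a b c : fibbox a b c = fibbox a c b.
Proof.
rewrite /fibbox addnAC [(b + c)%N]addnC.
by field; rewrite !fibsuperfact_neq0.
Qed.

Lemma fibo_hoggattE d n k : (k <= n)%N -> fibo_hoggatt d n k = fibbox d k (n - k).
Proof.
move=> lkn; rewrite -{1}(subnK lkn) addnC; move: (n - k)%N => c; rewrite /fibo_hoggatt.
have -> : \prod_(0 <= j < k)
    (fibonomial (k + c - j + d - 1) d / fibonomial (k - j + d - 1) d)
  = \prod_(0 <= j < k) (fibonomial (c + j + d) d / fibonomial (j + d) d).
  (* Reversing the product makes its factors independent of [k], as induction on [k] with [c] fixed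
     requires. *)
  rewrite big_nat_rev; apply: eq_big_nat => j /andP[_ ljk].
  by congr (fibonomial _ _ / fibonomial _ _); lia.
elim: {n lkn} k => [|k IH]; first by rewrite big_geq // fibbox0.
rewrite big_nat_recr // IH !fibonomialE; try lia.
rewrite !addnK /fibbox !addnS !addSn !fibsuperfactS.
have -> : (c + k + d = d + k + c)%N by lia.
rewrite [(c + k)%N]addnC [(d + k)%N]addnC [LHS]/=.
by field; rewrite !fibsuperfact_neq0 !fibfact_neq0.
Qed.

Lemma fibbox1 k c : fibbox 1 k c = fibonomial (k + c) k.
Proof.
rewrite fibonomialE ?leq_addr // addKn /fibbox !add1n addSn.
rewrite !fibsuperfactS [fibsuperfact 0]/= [fibfact 0]/=.
by field; rewrite !fibsuperfact_neq0 !fibfact_neq0.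
Qed.

(** Since K(m+2) K(m) / K(m+1)^2 is the Fibonacci number of index m+1, dividing by the square on the
    right leaves Vajda's identity divided by [F (c + d).+2 * F (k + d).+2]. *)
Lemma fibbox_condensation d k c :
  fibbox d.+2 k.+1 c.+1 * fibbox d k.+1 c.+1
  = fibbox d.+1 k.+1 c.+1 ^+ 2
    + (-1) ^+ d * (fibbox d.+1 k c.+2 * fibbox d.+1 k.+2 c).
Proof.
have superSS m : fibsuperfact m.+2 = F m.+1 * fibsuperfact m.+1 ^+ 2 / fibsuperfact m.
  by rewrite !fibsuperfactS fibfactS; field; rewrite fibsuperfact_neq0.
have V := fib_vajda d c.+1 k.+1.
rewrite /fibbox !(addSn, addnS); rewrite !(addSn, addnS) in V.
have -> : (d + k + c = c + k + d)%N by lia.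
rewrite ![(d + c)%N]addnC ![(d + k)%N]addnC.
(* Solving Vajda's identity for its largest term leaves an identity of rational functions. *)
have eF : F (c + k + d).+3 = (F (c + d).+2 * F (k + d).+2
    + (-1) ^+ d * (F c.+1 * F k.+1)) / F d.+1.
  by rewrite -V mulfK ?fibS_neq0.
rewrite (superSS (c + k + d).+2) eF (superSS d) (superSS k) (superSS c).
rewrite (superSS (c + d).+1) (superSS (k + d).+1).
field.
rewrite !fibsuperfact_neq0 !fibS_neq0 //.
Qed.

(** * Evaluation of the determinant *)

Lemma binom2D1 (m : int) : binom2 (m + 1) = binom2 m + m.
Proof.
rewrite /binom2 (_ : (m + 1) * (m + 1 - 1) = m * 2 + m * (m - 1)); last by ring.
by rewrite divzMDl // addrC.
Qed.

Lemma expN1zB (i j : nat) : (-1 : rat) ^ (i%:Z - j%:Z) = (-1) ^+ i * (-1) ^+ j.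
Proof. by rewrite expfzDr // -invr_expz -!exprnP -exprVn invrN1. Qed.

Definition signed_fibonomial (n : nat) (k : int) (i j : nat) : rat :=
  (-1) ^ binom2 (i%:Z - j%:Z) * fibonomial n (k - i%:Z + j%:Z).

(** The matrix is Toeplitz, so its minors shifted along the diagonal are again leading minors. *)
Lemma signed_fibonomialSS n k i j :
  signed_fibonomial n k i.+1 j.+1 = signed_fibonomial n k i j.
Proof. by rewrite /signed_fibonomial; congr ((-1) ^ binom2 _ * fibonomial _ _); lia. Qed.

(** By [binom2D1] the extra sign has exponent i-j, hence splits into a row sign and a column
    sign. *)
Lemma signed_fibonomialSl n k i j :
  signed_fibonomial n k i.+1 j
  = (-1) ^+ i * signed_fibonomial n (k - 1) i j * (-1) ^+ j.
Proof.
rewrite /signed_fibonomial (_ : i.+1%:Z - j%:Z = (i%:Z - j%:Z) + 1); last by lia.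
rewrite binom2D1 expfzDr // expN1zB.
rewrite (_ : k - 1 - i%:Z + j%:Z = k - i.+1%:Z + j%:Z); last by lia.
by ring.
Qed.

(** This is [signed_fibonomialSl] at [k + 1], inverted through the Toeplitz property; the minus
    comes from the column sign at [j.+1]. *)
Lemma signed_fibonomialSr n k i j :
  signed_fibonomial n k i j.+1
  = - (-1) ^+ i * signed_fibonomial n (k + 1) i j * (-1) ^+ j.
Proof.
have /eqP := signed_fibonomialSS n (k + 1) i j.
rewrite signed_fibonomialSl (_ : k + 1 - 1 = k); last by lia.
move=> /eqP <-; rewrite exprS.
have s2 m : (-1) ^+ m * (-1) ^+ m = 1 :> rat by rewrite -exprMn mulrNN mulr1 expr1n.
transitivity (((-1) ^+ i * (-1) ^+ i) * ((-1) ^+ j * (-1) ^+ j)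
   * signed_fibonomial n k i j.+1); first by rewrite !s2 !mul1r.
by ring.
Qed.

Lemma sign_prod m : \prod_(i < m) (-1) ^+ i * \prod_(i < m) (-1) ^+ i = 1 :> rat.
Proof.
rewrite -big_split big1 //= => i _.
by rewrite -exprMn mulrNN mulr1 expr1n.
Qed.

Lemma fibonomial_minor_condensation n (k : int) d :
  leading_minor (signed_fibonomial n k) d != 0 ->
  leading_minor (signed_fibonomial n k) d.+2 * leading_minor (signed_fibonomial n k) d
  = leading_minor (signed_fibonomial n k) d.+1 ^+ 2
    + (-1) ^+ d * (leading_minor (signed_fibonomial n (k - 1)) d.+1
                   * leading_minor (signed_fibonomial n (k + 1)) d.+1).
Proof.
have eSS m : leading_minor (fun i j => signed_fibonomial n k i.+1 j.+1) m
    = leading_minor (signed_fibonomial n k) m.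
  by apply: eq_leading_minor => i j _ _; exact: signed_fibonomialSS.
move=> nz; rewrite -(eSS d) desnanot_jacobi ?eSS //.
have -> : leading_minor (fun i j => signed_fibonomial n k i.+1 j) d.+1
    = leading_minor (signed_fibonomial n (k - 1)) d.+1.
  transitivity (leading_minor (fun i j =>
      (-1) ^+ i * signed_fibonomial n (k - 1) i j * (-1) ^+ j) d.+1).
    by apply: eq_leading_minor => i j _ _; exact: signed_fibonomialSl.
  by rewrite leading_minor_scale mulrAC sign_prod mul1r.
have -> : leading_minor (fun i j => signed_fibonomial n k i j.+1) d.+1
    = (-1) ^+ d.+1 * leading_minor (signed_fibonomial n (k + 1)) d.+1.
  transitivity (leading_minor (fun i j =>
      - (-1) ^+ i * signed_fibonomial n (k + 1) i j * (-1) ^+ j) d.+1).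
    by apply: eq_leading_minor => i j _ _; exact: signed_fibonomialSr.
  (* One minus per row gives the sign of exponent [d.+1], which the minus of [desnanot_jacobi]
     changes to exponent [d]. *)
  rewrite (leading_minor_scale _ (fun i => - (-1) ^+ i)) mulrAC prodrN card_ord.
  by rewrite -[X in X * _]mulrA sign_prod mulr1.
by rewrite expr2 exprS; ring.
Qed.

Lemma leading_minor_fibonomial d n k : (k <= n)%N ->
  leading_minor (signed_fibonomial n k) d = fibbox d k (n - k).
Proof.
(* The recurrence reaches two orders back and moves [k] both ways, hence strong induction with [k]
   general. *)
elim/ltn_ind: d k => -[|[|d]] IH k lkn.
- rewrite /leading_minor det_mx00 /fibbox !add0n.
  by rewrite [fibsuperfact 0]/=; field; rewrite !fibsuperfact_neq0.
- rewrite /leading_minor det_mx11 mxE fibbox1 subnKC // /signed_fibonomial.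
  by rewrite subrr /binom2 mul0r div0z expr0z mul1r subr0 addr0.
have IH0 : leading_minor (signed_fibonomial n k) d = fibbox d k (n - k).
  by apply: IH => //; lia.
have nz : leading_minor (signed_fibonomial n k) d != 0.
  by rewrite IH0 gt_eqF ?fibbox_gt0.
apply: (mulIf nz); rewrite fibonomial_minor_condensation // IH0 (IH d.+1 _ k) //.
case: k lkn {nz IH0} => [|k] lkn.
  (* At k = 0 the minor for k-1 vanishes: its first column has lower indices -1-j. *)
  rewrite -leading_minor_tr (leading_minor_zero_row (i := 0%N)) //; last first.
    by move=> j; rewrite /signed_fibonomial (_ : _ - _ + _ = Negz j) ?mulr0 //; lia.
  by rewrite mul0r mulr0 addr0 !fibbox0 expr2.
case: (ltngtP k.+1 n) lkn => // [lkn _|<- _].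
  have -> : k.+1%:Z - 1 = k by lia.
  have -> : k.+1%:Z + 1 = k.+2 by lia.
  rewrite !IH //; try lia.
  have -> : (n - k.+1 = (n - k.+2).+1)%N by lia.
  have -> : (n - k = (n - k.+2).+2)%N by lia.
  by rewrite fibbox_condensation.
(* At k = n the minor for k+1 vanishes: its first row has lower indices n+1+j. *)
rewrite [X in _ * (_ * X)](leading_minor_zero_row (i := 0%N)) //; last first.
  move=> j; rewrite /signed_fibonomial (_ : _ - _ + j%:Z = (k.+2 + j)%:Z); last by lia.
  by rewrite fibonomial_small ?mulr0 //; lia.
by rewrite !mulr0 addr0 subnn !(fibboxC _ _ 0) !fibbox0 expr2.
Qed.

Theorem theorem12 (d n k : nat) (hd : (0 < d)%N) (hkn : (k <= n)%N) :
  \det (\matrix_(i < d, j < d)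
          ((-1) ^ binom2 (i%:Z - j%:Z) * fibonomial n (k%:Z - i%:Z + j%:Z)))
    = fibo_hoggatt d n k
  /\ (fibo_hoggatt d n k \is a Num.int /\ 0 < fibo_hoggatt d n k).
Proof.
have detE : leading_minor (signed_fibonomial n k) d = fibo_hoggatt d n k.
  by rewrite leading_minor_fibonomial // fibo_hoggattE.
split; first exact: detE.
split; last by rewrite fibo_hoggattE // fibbox_gt0.
rewrite -detE; apply: leading_minor_int => i j.
apply: rpredM (fibonomial_int _ _).
(* Treating both signs of the exponent avoids proving [binom2] nonnegative. *)
case: (binom2 _) => m; first by rewrite -exprnP rpredX ?rpredN1.
by rewrite /exprz -exprVn invrN1 rpredX ?rpredN1.
Qed.
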